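(* Let $A$ be an $n\times n$ symmetric tropical matrix (i.e. a symmetric matrix with real entries). Then $A$ has symmetric Kapranov rank two over $\mathcal{R}$ if and only if $A$ has symmetric tropical rank two.
   Context: Let $\mathcal{C}=\mathbb{C}\{\!\{t\}\!\}$ and $\mathcal{R}=\mathbb{R}\{\!\{t\}\!\}$ be the fields of complex and real Puiseux series, with valuation $\mathrm{val}(a)$ = the exponent of the lowest degree term of $a\ne0$. For a variety $X\subset\mathcal{C}^N$ and $\mathcal{K}\in\{\mathcal{C},\mathcal{R}\}$, let $\mathrm{trop}_{\mathcal{K}}(X)=\overline{\{\mathrm{val}(x): x\in X\cap(\mathcal{K}^* )^N\}}\subset\mathbb{R}^N$ (coordinatewise valuation, Euclidean closure). Let $\mathcal{S}^r_n\subset\mathcal{C}^{\binom{n+1}{2}}$ be the variety of symmetric $n\times n$ matrices of rank at most $r$ (coordinates: the entries on and above the diagonal); its tropicalizations are viewed as sets of real symmetric $n\times n$ matrices. The symmetric Kapranov rank over $\mathcal{K}$ of a symmetric $n\times n$ tropical matrix $A$ is the smallest $r$ such that $A\in\mathrm{trop}_{\mathcal{K}}(\mathcal{S}^r_n)$. A $k\times k$ tropical matrix $(a_{ij})$ is tropically singular if $\min_{\sigma\in S_k}(a_{1\sigma(1)}+\dots+a_{k\sigma(k)})$ is attained by at least two permutations $\sigma$. A symmetric $k\times k$ tropical matrix is tropically symmetrically singular if this minimum is attained at two distinct monomials in the variables $a_{ij}$, $i\le j$, where $a_{ij}$ and $a_{ji}$ are identified (so two permutations giving the same monomial in the symmetric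 determinant are counted once). The symmetric tropical rank of a symmetric tropical matrix $A$ is the size of the largest nonsingular square submatrix of $A$, where ''singular'' means tropically symmetrically singular for principal submatrices and tropically singular for non-principal submatrices. *)

(* Defs.v *)
From HB Require Import structures.
From mathcomp Require Import all_boot all_order fingroup perm all_algebra.
From mathcomp Require Import zify.
From mathcomp Require Import complex.
From mathcomp Require Import mathcomp_extra boolp classical_sets functions.
From mathcomp Require Import cardinality fsbigop reals topology normedtype.

Set Implicit Arguments.
Unset Strict Implicit.
Unset Printing Implicit Defensive.

Import Order.TTheory GRing.Theory Num.Theory.
Import numFieldNormedType.Exports.

Local Open Scope classical_set_scope.
Local Open Scope ring_scope.

(** * The field of Puiseux series

   A Puiseux series \sum_q c_q t^q is given by its coefficient function
   c : rat -> F, whose support lies in {k / d | k >= m} for some positive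
   integer d and some integer m. *)

Section Coefficients.
Variable F : fieldType.
Implicit Types (a b c : rat -> F) (d e : nat) (m : int).

Definition supp_in d m c : Prop :=
  forall q : rat, c q != 0 -> exists2 k : int, m <= k & q = k%:~R / d%:R.

Definition is_puiseux c : Prop :=
  exists d m, (0 < d)%N /\ supp_in d m c.

Definition cauchy a b : rat -> F :=
  fun q => \sum_(p \in [set: rat]) a p * b (q - p).

(* The i-th point of { k / d | k >= m }. *)
Definition pos d m (i : nat) : rat := (m + i%:Z)%:~R / d%:R.

Lemma supp_inW d m e m' c : (0 < e)%N -> m' <= m * e%:Z ->
  supp_in d m c -> supp_in (d * e) m' c.
Proof.
move=> e0 le_m' sc q /sc[k le_mk ->]; exists (k * e%:Z).
  by apply: (le_trans le_m'); rewrite ler_wpM2r.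
rewrite intrM natrM invfM mulrACA -pmulrn divff ?mulr1 //.
by rewrite pnatr_eq0 -lt0n.
Qed.

Lemma common2 a b : is_puiseux a -> is_puiseux b ->
  exists d m, [/\ (0 < d)%N, supp_in d m a & supp_in d m b].
Proof.
move=> [d [m [d0 sa]]] [e [m' [e0 sb]]].
exists (d * e)%N, (Num.min (m * e%:Z) (m' * d%:Z)); split.
- by rewrite muln_gt0 d0.
- by apply: supp_inW sa => //; rewrite ge_min lexx.
- by rewrite mulnC; apply: supp_inW sb => //; rewrite ge_min lexx orbT.
Qed.

Lemma common3 a b c : is_puiseux a -> is_puiseux b -> is_puiseux c ->
  exists d m, [/\ (0 < d)%N, supp_in d m a, supp_in d m b & supp_in d m c].
Proof.
move=> pa pb [e [m' [e0 sc]]].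
have [d [m [d0 sa sb]]] := common2 pa pb.
exists (d * e)%N, (Num.min (m * e%:Z) (m' * d%:Z)); split.
- by rewrite muln_gt0 d0.
- by apply: supp_inW sa => //; rewrite ge_min lexx.
- by apply: supp_inW sb => //; rewrite ge_min lexx.
- by rewrite mulnC; apply: supp_inW sc => //; rewrite ge_min lexx orbT.
Qed.

Lemma posP d m c q : supp_in d m c -> c q != 0 -> exists i, q = pos d m i.
Proof.
move=> sc /sc[k le_mk ->]; exists `|k - m|%N.
by rewrite /pos gez0_abs ?subr_ge0 // subrKC.
Qed.

Lemma pos_inj d m : (0 < d)%N -> injective (pos d m).
Proof.
move=> d0 i j; rewrite /pos => /(congr1 ( *%R^~ d%:R)).
have dn0 : d%:R != 0 :> rat by rewrite pnatr_eq0 -lt0n.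
by rewrite !divfK // => /intr_inj /addrI[].
Qed.

Lemma posB d m m' (n i : nat) : (i <= n)%N ->
  pos d (m + m') n - pos d m i = pos d m' (n - i).
Proof.
by move=> le_in; rewrite /pos -mulrBl -intrB; congr (_%:~R / _); lia.
Qed.

Lemma posBI d m m' (n i j : nat) : (0 < d)%N ->
  pos d (m + m') n - pos d m i = pos d m' j -> (i <= n)%N.
Proof.
move=> d0; rewrite /pos -mulrBl -intrB => /(congr1 ( *%R^~ d%:R)).
have dn0 : d%:R != 0 :> rat by rewrite pnatr_eq0 -lt0n.
by rewrite !divfK // => /intr_inj E; lia.
Qed.

Lemma cauchyE d m m' a b n : (0 < d)%N -> supp_in d m a -> supp_in d m' b ->
  cauchy a b (pos d (m + m') n) =
  \sum_(i < n.+1) a (pos d m i) * b (pos d m' (n - i)).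
Proof.
move=> d0 sa sb.
pose r := [seq pos d m i | i <- index_iota 0 n.+1].
rewrite /cauchy (fsbigE r) //; first last.
- move=> p _; apply: contraNeq; rewrite mulf_eq0 negb_or => /andP[ap bp].
  have [i pE] := posP sa ap; have [j qE] := posP sb bp.
  have le_in : (i <= n)%N.
    by apply: (posBI (m := m) (m' := m') (j := j) d0); rewrite -pE.
  by apply/mapP; exists i; rewrite // mem_index_iota.
- by rewrite map_inj_uniq ?iota_uniq //; exact: pos_inj.
under eq_bigl do rewrite in_setT.
rewrite big_map big_mkord.
by apply: eq_bigr => i _; rewrite posB // -ltnS.
Qed.

Lemma cauchy_supp d m m' a b : (0 < d)%N -> supp_in d m a -> supp_in d m' b ->
  supp_in d (m + m') (cauchy a b).
Proof.
move=> d0 sa sb q; apply: contraNP => nq; apply/eqP.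
apply: fsbig1 => p _; apply/eqP; apply: contra_notT nq.
rewrite mulf_eq0 negb_or => /andP[/sa[k lek pE] /sb[k' lek' qE]].
exists (k + k'); first exact: lerD.
by rewrite intrD mulrDl -pE -qE addrC subrK.
Qed.

Lemma supp_eq d m a b : supp_in d m a -> supp_in d m b ->
  (forall n, a (pos d m n) = b (pos d m n)) -> a = b.
Proof.
move=> sa sb ab; apply/funext => q.
have [aq|/posP-/(_ _ _ sa)[i ->] //] := eqVneq (a q) 0.
have [bq|/posP-/(_ _ _ sb)[i ->] //] := eqVneq (b q) 0.
by rewrite aq bq.
Qed.

Definition trunc d m a n : {poly F} := \poly_(i < n.+1) a (pos d m i).

Lemma coef_trunc d m a n i : (i <= n)%N -> (trunc d m a n)`_i = a (pos d m i).
Proof. by move=> le_in; rewrite coef_poly ltnS le_in. Qed.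

Lemma cauchy_trunc d m m' a b n i : (0 < d)%N ->
    supp_in d m a -> supp_in d m' b -> (i <= n)%N ->
  cauchy a b (pos d (m + m') i) = (trunc d m a n * trunc d m' b n)`_i.
Proof.
move=> d0 sa sb le_in; rewrite cauchyE // coefM; apply: eq_bigr => j _.
have le_ji : (j <= i)%N by rewrite -ltnS.
by rewrite !coef_trunc //; lia.
Qed.

Lemma cauchyC a b : is_puiseux a -> is_puiseux b -> cauchy a b = cauchy b a.
Proof.
move=> pa pb; have [d [m [d0 sa sb]]] := common2 pa pb.
apply: (@supp_eq d (m + m)); [exact: cauchy_supp..|move=> n].
by rewrite !(@cauchy_trunc _ _ _ _ _ n) // mulrC.
Qed.

Lemma cauchyA a b c : is_puiseux a -> is_puiseux b -> is_puiseux c ->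
  cauchy a (cauchy b c) = cauchy (cauchy a b) c.
Proof.
move=> pa pb pc; have [d [m [d0 sa sb sc]]] := common3 pa pb pc.
have sab : supp_in d (m + m) (cauchy a b) by exact: cauchy_supp.
have sbc : supp_in d (m + m) (cauchy b c) by exact: cauchy_supp.
have sl : supp_in d (m + (m + m)) (cauchy a (cauchy b c)).
  exact: cauchy_supp.
have sr : supp_in d (m + (m + m)) (cauchy (cauchy a b) c).
  by rewrite addrA; exact: cauchy_supp.
apply: (supp_eq sl sr) => n.
rewrite [RHS](_ : _ = (trunc d m a n * trunc d m b n * trunc d m c n)`_n).
  rewrite (cauchyE _ d0 sa sbc) -mulrA coefM; apply: eq_bigr => i _.
  have le_in : (i <= n)%N by rewrite -ltnS.
  by rewrite coef_trunc // (cauchy_trunc d0 sb sc (leq_subr i n)).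
rewrite addrA (cauchyE _ d0 sab sc) coefM; apply: eq_bigr => i _.
have le_in : (i <= n)%N by rewrite -ltnS.
by rewrite coef_trunc ?leq_subr // (cauchy_trunc d0 sa sb le_in).
Qed.

Definition delta0 : rat -> F := fun q => (q == 0)%:R.

Lemma delta0_supp d : supp_in d 0 delta0.
Proof.
move=> q; rewrite /delta0; have [->|_] := eqVneq q 0; last by rewrite eqxx.
by exists 0; rewrite // mul0r.
Qed.

Lemma cauchy1c a : cauchy delta0 a = a.
Proof.
apply/funext => q; rewrite /cauchy (fsbigE [:: 0]) //=.
  by rewrite big_cons big_nil in_setT addr0 subr0 /delta0 eqxx mul1r.
by move=> p _; rewrite inE /delta0 => /negbTE->; rewrite mul0r.
Qed.

Lemma cauchyDl a b c : is_puiseux a -> is_puiseux b -> is_puiseux c ->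
  cauchy (fun q => a q + b q) c = fun q => cauchy a c q + cauchy b c q.
Proof.
move=> pa pb pc; have [d [m [d0 sa sb sc]]] := common3 pa pb pc.
have addS (u v : rat -> F) k : supp_in d k u -> supp_in d k v ->
    supp_in d k (fun q => u q + v q).
  move=> su sv q; have [->|/su //] := eqVneq (u q) 0.
  by rewrite add0r => /sv.
apply: (@supp_eq d (m + m)).
- by apply: cauchy_supp => //; exact: addS.
- by apply: addS; exact: cauchy_supp.
move=> n; rewrite !(@cauchyE d m m) //; last exact: addS.
by rewrite -big_split /=; apply: eq_bigr => i _; rewrite mulrDl.
Qed.

Lemma is_puiseux_cauchy a b :
  is_puiseux a -> is_puiseux b -> is_puiseux (cauchy a b).
Proof.
move=> pa pb; have [d [m [d0 sa sb]]] := common2 pa pb.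
by exists d, (m + m); split=> //; exact: cauchy_supp.
Qed.

Lemma is_puiseux0 : is_puiseux (fun=> 0).
Proof. by exists 1%N, 0; split=> // q; rewrite eqxx. Qed.

Lemma is_puiseux1 : is_puiseux delta0.
Proof. by exists 1%N, 0; split=> //; exact: delta0_supp. Qed.

Lemma is_puiseuxN a : is_puiseux a -> is_puiseux (fun q => - a q).
Proof.
move=> [d [m [d0 sa]]]; exists d, m; split=> // q.
by rewrite oppr_eq0; exact: sa.
Qed.

Lemma is_puiseuxD a b : is_puiseux a -> is_puiseux b ->
  is_puiseux (fun q => a q + b q).
Proof.
move=> pa pb; have [d [m [d0 sa sb]]] := common2 pa pb.
exists d, m; split=> // q; have [->|/sa //] := eqVneq (a q) 0.
by rewrite add0r => /sb.
Qed.

Lemma series_inverse (u : nat -> F) : u 0%N != 0 ->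
  exists v : nat -> F,
    forall n, \sum_(i < n.+1) v i * u (n - i)%N = (n == 0%N)%:R.
Proof.
move=> u0.
pose step (s : seq F) := rcons s
  (((size s == 0%N)%:R - \sum_(i < size s) s`_i * u (size s - i)%N) / u 0%N).
pose L n := iter n step [::].
have sL n : size (L n) = n by elim: n => //= n IH; rewrite size_rcons IH.
have stable n i : (i < n)%N -> (L n)`_i = (L i.+1)`_i.
  elim: n => // n IH; rewrite ltnS leq_eqVlt => /orP[/eqP->//|lt_in].
  by rewrite -IH //= nth_rcons sL lt_in.
exists (fun i => (L i.+1)`_i) => n.
rewrite big_ord_recr /= subnn [in X in _ + X]nth_rcons sL ltnn eqxx.
rewrite divfK // [X in X + _](eq_bigr (fun i : 'I_n => (L n)`_i * u (n - i)%N)).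
  by rewrite addrC subrK.
by move=> i _; rewrite [in RHS]stable.
Qed.

Lemma leading_exponent a q0 : is_puiseux a -> a q0 != 0 ->
  exists d m, [/\ (0 < d)%N, supp_in d m a & a (pos d m 0) != 0].
Proof.
move=> [d [m [d0 sa]]] aq0.
have ex : exists i, a (pos d m i) != 0.
  by have [i qE] := posP sa aq0; exists i; rewrite -qE.
case: (ex_minnP ex) => i ai mini; exists d, (m + i%:Z); split=> //.
  move=> q aq; have [j qE] := posP sa aq.
  exists (m + j%:Z); last by rewrite qE.
  by rewrite lerD2l lez_nat; apply: mini; rewrite -qE.
by rewrite /pos addr0.
Qed.

Lemma cauchy_inverse a : is_puiseux a -> a <> (fun=> 0) ->
  exists2 b, is_puiseux b & cauchy b a = delta0.
Proof.
move=> pa a0; have [q0 aq0] : exists q, a q != 0.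
  apply: contrapT => na; apply: a0; apply/funext => q; apply/eqP.
  by apply: contra_notT na => aq; exists q.
have [d [m [d0 sa am]]] := leading_exponent pa aq0.
have [v vP] := @series_inverse (fun i => a (pos d m i)) am.
pose b q := if pselect (exists i, q = pos d (- m) i) is left ex
            then v (projT1 (cid ex)) else 0.
have bE i : b (pos d (- m) i) = v i.
  rewrite /b; case: pselect => [ex|[]]; last by exists i.
  by case: cid => j /= /(pos_inj d0) ->.
have sb : supp_in d (- m) b.
  move=> q; rewrite /b; case: pselect => [[i qE] _|_]; last by rewrite eqxx.
  by exists (- m + i%:Z); rewrite ?lerDl.
exists b; first by exists d, (- m).
apply: (@supp_eq d 0); [|exact: delta0_supp|move=> n].
  by rewrite -[0](addNr m); exact: cauchy_supp.
rewrite -[X in pos d X n](addNr m) cauchyE //.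
under eq_bigr do rewrite bE.
rewrite vP addNr /delta0 /pos add0r mulf_eq0 invr_eq0 !pnatr_eq0.
by rewrite [d == _]eqn0Ngt d0 orbF.
Qed.

End Coefficients.

Record puiseux (F : fieldType) := Puiseux {
  pcoef : rat -> F;
  _ : `[< is_puiseux pcoef >]
}.

HB.instance Definition _ (F : fieldType) := [isSub for @pcoef F].
HB.instance Definition _ (F : fieldType) := [Choice of puiseux F by <:].

Section PuiseuxField.
Variable F : fieldType.
Implicit Types x y z : puiseux F.

Definition mk_puiseux c (pc : is_puiseux c) : puiseux F :=
  Puiseux (introT (asboolP _) pc).

Lemma pcoefP x : is_puiseux (pcoef x).
Proof. by case: x => c /= /asboolP. Qed.

Lemma puiseux_eqP x y : pcoef x = pcoef y -> x = y.
Proof. exact: val_inj. Qed.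

Definition puiseux_zero := mk_puiseux (is_puiseux0 F).
Definition puiseux_one := mk_puiseux (is_puiseux1 F).
Definition puiseux_opp x := mk_puiseux (is_puiseuxN (pcoefP x)).
Definition puiseux_add x y := mk_puiseux (is_puiseuxD (pcoefP x) (pcoefP y)).
Definition puiseux_mul x y :=
  mk_puiseux (is_puiseux_cauchy (pcoefP x) (pcoefP y)).
Definition puiseux_inv x : puiseux F :=
  xget puiseux_zero [set y | puiseux_mul y x = puiseux_one].

Fact puiseux_addA : associative puiseux_add.
Proof.
by move=> x y z; apply: puiseux_eqP; apply/funext => q /=; rewrite addrA.
Qed.

Fact puiseux_addC : commutative puiseux_add.
Proof.
by move=> x y; apply: puiseux_eqP; apply/funext => q /=; rewrite addrC.
Qed.

Fact puiseux_add0 : left_id puiseux_zero puiseux_add.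
Proof. by move=> x; apply: puiseux_eqP; apply/funext => q /=; rewrite add0r. Qed.

Fact puiseux_addN : left_inverse puiseux_zero puiseux_opp puiseux_add.
Proof. by move=> x; apply: puiseux_eqP; apply/funext => q /=; rewrite addNr. Qed.

HB.instance Definition _ := GRing.isZmodule.Build (puiseux F)
  puiseux_addA puiseux_addC puiseux_add0 puiseux_addN.

Fact puiseux_mulA : associative puiseux_mul.
Proof.
move=> x y z; apply: puiseux_eqP => /=.
by apply: cauchyA; exact: pcoefP.
Qed.

Fact puiseux_mulC : commutative puiseux_mul.
Proof.
by move=> x y; apply: puiseux_eqP => /=; apply: cauchyC; exact: pcoefP.
Qed.

Fact puiseux_mul1 : left_id puiseux_one puiseux_mul.
Proof. by move=> x; apply: puiseux_eqP => /=; exact: cauchy1c. Qed.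

Fact puiseux_mulDl : left_distributive puiseux_mul puiseux_add.
Proof.
move=> x y z; apply: puiseux_eqP => /=.
by apply: cauchyDl; exact: pcoefP.
Qed.

Fact puiseux_one_neq0 : puiseux_one != 0.
Proof.
apply/eqP => /(congr1 (fun x => pcoef x 0)) /= /eqP.
by rewrite /delta0 eqxx oner_eq0.
Qed.

HB.instance Definition _ := GRing.Zmodule_isComNzRing.Build (puiseux F)
  puiseux_mulA puiseux_mulC puiseux_mul1 puiseux_mulDl puiseux_one_neq0.

Fact puiseux_mulV x : x != 0 -> puiseux_inv x * x = 1.
Proof.
move=> x0; apply: (@xgetPex _ puiseux_zero [set y | puiseux_mul y x = puiseux_one]).
have [|b pb bE] := cauchy_inverse (pcoefP x).
  by move=> xE; move/eqP: x0; apply; apply: puiseux_eqP.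
by exists (mk_puiseux pb); apply: puiseux_eqP.
Qed.

Fact puiseux_inv0 : puiseux_inv 0 = 0.
Proof.
apply: xgetPN => y /= y0; move: (oner_neq0 (puiseux F)).
by rewrite -[1]/puiseux_one -y0 -[puiseux_mul y 0]/(y * 0) mulr0 eqxx.
Qed.

HB.instance Definition _ := GRing.ComNzRing_isField.Build (puiseux F)
  puiseux_mulV puiseux_inv0.

(* Junk value 0 at x = 0. *)
Definition pval x : rat :=
  xget 0 [set q | pcoef x q != 0 /\ forall p, pcoef x p != 0 -> q <= p].

Lemma pvalP x : x != 0 ->
  pcoef x (pval x) != 0 /\ forall p, pcoef x p != 0 -> pval x <= p.
Proof.
move=> x0; apply: (@xgetPex _ 0
  [set q | pcoef x q != 0 /\ forall p, pcoef x p != 0 -> q <= p]).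
have [q0 xq0] : exists q, pcoef x q != 0.
  apply: contrapT => nx; move/eqP: x0; apply; apply: puiseux_eqP.
  apply/funext => q /=; apply/eqP; apply: contra_notT nx => xq.
  by exists q.
have [d [m [d0 sx xm]]] := leading_exponent (pcoefP x) xq0.
exists (pos d m 0); split=> // p /sx[k le_mk ->].
by rewrite /pos addr0 ler_pM2r ?invr_gt0 ?ltr0n // ler_int.
Qed.

End PuiseuxField.

(** * Tropicalization and symmetric Kapranov rank

   The real field is modelled by an arbitrary R : realType, and complex
   numbers by R[i].  The affine space with one coordinate for each entry on or
   above the diagonal is identified with the space of symmetric matrices; a
   symmetric matrix has nonzero (resp. real) entries as soon as those on and
   above the diagonal are nonzero (resp. real), and the space of symmetric
   matrices is closed in the space of all matrices, so the tropicalization is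
   the same in either space. *)

(* The subfield R{{t}} of C{{t}}. *)
Definition real_puiseux (R : realType) : set (puiseux R[i]) :=
  [set a | forall q, complex.Im (pcoef a q) = 0].

Section Kapranov.
Variable R : realType.

Definition trop (K : set (puiseux R[i])) (m n : nat)
    (X : set 'M[puiseux R[i]]_(m, n)) : set 'M[R]_(m, n) :=
  closure [set map_mx (fun a => ratr (pval a) : R) x
    | x in [set x | X x /\ forall i j, K (x i j) /\ x i j != 0]].

Definition sym_rank_le (n r : nat) : set 'M[puiseux R[i]]_n :=
  [set x | x^T = x /\ (\rank x <= r)%N].

Definition has_symmetric_Kapranov_rank (K : set (puiseux R[i])) (n : nat)
    (A : 'M[R]_n) (r : nat) : Prop :=
  trop K (@sym_rank_le n r) A /\
  forall s : nat, trop K (@sym_rank_le n s) A -> (r <= s)%N.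

End Kapranov.

(** * Symmetric tropical rank *)

Section TropicalRank.
Variable R : realType.

Definition trop_weight (k : nat) (A : 'M[R]_k) (s : 'S_k) : R :=
  \sum_(i < k) A i (s i).

Definition attains_min (k : nat) (A : 'M[R]_k) (s : 'S_k) : bool :=
  [forall t : 'S_k, trop_weight A s <= trop_weight A t].

Definition trop_singular (k : nat) (A : 'M[R]_k) : bool :=
  [exists s : 'S_k, exists t : 'S_k,
    [&& s != t, attains_min A s & attains_min A t]].

(* The monomial \prod_l x_(l, s l), with x_(i, j) and x_(j, i) identified,
   given by the exponent of x_(i, j) for each i <= j (and 0 when j < i). *)
Definition sym_monomial (k : nat) (s : 'S_k) : {ffun 'I_k * 'I_k -> nat} :=
  [ffun p : 'I_k * 'I_k =>
    #|[set l : 'I_k | (minn l (s l) == p.1 :> nat)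
                      && (maxn l (s l) == p.2 :> nat)]|].

Definition trop_sym_singular (k : nat) (A : 'M[R]_k) : bool :=
  [exists s : 'S_k, exists t : 'S_k,
    [&& sym_monomial s != sym_monomial t, attains_min A s & attains_min A t]].

Definition increasing (k n : nat) (f : {ffun 'I_k -> 'I_n}) : bool :=
  [forall i : 'I_k, forall j : 'I_k, (i < j)%N ==> (f i < f j)%N].

(* The rows (resp. columns) of a k x k submatrix are selected by an increasing
   map f (resp. g); the submatrix is principal when f = g. *)
Definition has_nonsingular_submx (n : nat) (A : 'M[R]_n) (k : nat) : bool :=
  [exists f : {ffun 'I_k -> 'I_n}, exists g : {ffun 'I_k -> 'I_n},
    [&& increasing f, increasing g
      & if f == g then ~~ trop_sym_singular (mxsub f g A)
        else ~~ trop_singular (mxsub f g A)]].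

Definition symmetric_tropical_rank (n : nat) (A : 'M[R]_n) : nat :=
  \max_(k < n.+1 | has_nonsingular_submx A k) k.

End TropicalRank.

(* Main.v *)
From mathcomp Require Import all_boot all_order fingroup perm all_algebra.
From mathcomp Require Import zify complex ring lra.
From mathcomp Require Import boolp classical_sets.
From mathcomp Require Import fsbigop reals topology normedtype.
Require Import Defs.

(* If [A] is in the tropicalization of the matrices of rank at most [r], the
   lowest-order terms of each vanishing [k x k] minor with [k > r] must cancel,
   hence come from two monomials.

   Conversely, suppose that all 3x3 minors of [A] are singular, and put
   [o i j = 2 A i j - A i i - A j j].  The principal 3x3 minors force every
   triple of the pseudometric [sep = max 0 (- o)] to embed in a line; the only
   obstruction to embedding all points at once, a four-point configuration with
   equal opposite sides, is excluded by a nonprincipal minor.  So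
   [sep i j = |z i - z j|].  Another nonprincipal minor shows that
   [height = max 0 o] satisfies an ultrametric inequality along paths of length
   three, so that [height i j / 2 = val (w i + w j)] for some real units [w i].
   Then [t^(u i + u j) (t^(z i) w i + t^(z j) w j)], with
   [2 u i + z i = A i i], is a real symmetric matrix of rank at most two with
   valuation [A].  Since valuations are rational, all this is done after
   rounding [u], [z] and [height / 2] to multiples of [1 / (N + 1)]. *)

Set Implicit Arguments.
Unset Strict Implicit.
Unset Printing Implicit Defensive.

Import Order.TTheory GRing.Theory Num.Theory.
Import numFieldNormedType.Exports.

Local Open Scope ring_scope.

(** * Leading terms of Puiseux series *)

Section LeadingTerm.
Variable F : fieldType.
Implicit Types (x y : puiseux F) (a b q : rat) (c d : F).

(* [c] may vanish: [x = c t^q + higher terms]. *)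
Definition lead x q c : Prop :=
  pcoef x q = c /\ forall p, p < q -> pcoef x p = 0.

Lemma lead_pcoef x : x != 0 -> lead x (pval x) (pcoef x (pval x)).
Proof.
move=> /pvalP[_ minx]; split=> // p; rewrite ltNge => /negP lt_pq.
by apply/eqP; apply: contra_notT lt_pq => /minx.
Qed.

Lemma lead_pval x q c : lead x q c -> c != 0 -> x != 0 /\ pval x = q.
Proof.
move=> [xq low] c0; have x0 : x != 0.
  by apply: contraNneq c0 => x0; rewrite -xq x0.
split=> //; have [xv minx] := pvalP x0.
apply/eqP; rewrite eq_le minx ?xq // leNgt /=.
by apply: contra xv => /low ->.
Qed.

Lemma lead_lt x q c p : lead x q c -> p < q -> lead x p 0.
Proof.
move=> [_ low] lt_pq; split=> [|p' lt_p']; apply: low => //.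
exact: lt_trans lt_pq.
Qed.

Lemma lead0 q : lead 0 q 0.
Proof. by []. Qed.

Lemma leadD x y q c d : lead x q c -> lead y q d -> lead (x + y) q (c + d).
Proof.
by move=> [<- lx] [<- ly]; split=> // p lt_pq; rewrite /= lx ?ly ?addr0.
Qed.

Lemma leadN x q c : lead x q c -> lead (- x) q (- c).
Proof. by move=> [<- lx]; split=> // p lt_pq; rewrite /= lx ?oppr0. Qed.

Lemma lead1 : lead 1 0 1.
Proof.
by split=> [|p]; rewrite /= /delta0 ?eqxx // => /lt_eqF ->.
Qed.

(** Only the index [a] contributes to the convolution at [a + b]: below it [x] vanishes, and above
    it the argument of [y] drops below [b]. *)
Lemma leadM x y a b c d :
  lead x a c -> lead y b d -> lead (x * y) (a + b) (c * d).
Proof.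
move=> [<- lx] [<- ly]; split=> [|q lt_q] /=; rewrite /cauchy.
  rewrite (fsbigE [:: a]) //=.
    by rewrite big_cons big_nil in_setT addr0 addrAC subrr add0r.
  move=> p _; rewrite inE => p_a.
  have [lt_pa|] := ltP p a; first by rewrite lx ?mul0r.
  rewrite le_eqVlt eq_sym (negPf p_a) /= => lt_ap.
  by rewrite ly ?mulr0 // ltrBlDr [b + p]addrC ltrD2r.
apply: fsbig1 => p _; have [lt_pa|le_ap] := ltP p a.
  by rewrite lx ?mul0r.
rewrite ly ?mulr0 // ltrBlDr (lt_le_trans lt_q) //.
by rewrite [b + p]addrC lerD2r.
Qed.

Lemma lead_sum (I : finType) (x : I -> puiseux F) q (c : I -> F) :
  (forall i, lead (x i) q (c i)) -> lead (\sum_i x i) q (\sum_i c i).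
Proof.
move=> xl; elim/big_ind2: _ => [|u c1 v c2|i _]; [exact: lead0| |exact: xl].
exact: leadD.
Qed.

Lemma lead_prod (I : finType) (x : I -> puiseux F) (q : I -> rat) (c : I -> F) :
  (forall i, lead (x i) (q i) (c i)) ->
  lead (\prod_i x i) (\sum_i q i) (\prod_i c i).
Proof.
move=> xl; elim: (index_enum I) => [|i r IH]; rewrite ?big_nil ?big_cons.
  exact: lead1.
exact: leadM.
Qed.

Lemma lead_signM (b : bool) x q c :
  lead x q c -> lead ((-1) ^+ b * x) q ((-1) ^+ b * c).
Proof.
by case: b; rewrite ?expr0 ?expr1 ?mul1r ?mulN1r //; exact: leadN.
Qed.

Lemma is_puiseux_mono q : is_puiseux (fun p => (p == q)%:R : F).
Proof.
exists `|denq q|%N, (numq q); split; first by rewrite absz_gt0 denq_neq0.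
move=> p; have [->|_] := eqVneq p q; last by rewrite eqxx.
by exists (numq q); rewrite // pmulrn absz_denq divq_num_den.
Qed.

Definition mono q : puiseux F := mk_puiseux (is_puiseux_mono q).

Lemma lead_mono q : lead (mono q) q 1.
Proof. by split=> [|p]; rewrite /= ?eqxx // => /lt_eqF ->. Qed.

Lemma monoD a b : mono (a + b) = mono a * mono b.
Proof.
apply: puiseux_eqP; apply/funext => q /=.
rewrite /cauchy (fsbigE [:: a]) //=.
  by rewrite big_cons big_nil in_setT addr0 eqxx mul1r subr_eq addrC.
by move=> p _; rewrite inE => /negPf ->; rewrite mul0r.
Qed.

End LeadingTerm.

(** * Closure properties of real Puiseux series *)

Section RealPuiseux.
Variable R : realType.
Implicit Types x y : puiseux R[i].

Lemma real_puiseuxD x y :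
  real_puiseux x -> real_puiseux y -> real_puiseux (x + y).
Proof.
move=> rx ry q; move: (rx q) (ry q) => /=.
by case: (pcoef x q) => a b; case: (pcoef y q) => c d /= -> ->; rewrite addr0.
Qed.

Lemma real_puiseuxM x y :
  real_puiseux x -> real_puiseux y -> real_puiseux (x * y).
Proof.
move=> rx ry q /=; rewrite /cauchy; elim/big_ind: _ => //.
  by case=> [a b] [c d] /= -> ->; rewrite addr0.
move=> p _; move: (rx p) (ry (q - p)).
case: (pcoef x p) => a b; case: (pcoef y _) => c d /= -> ->.
by rewrite mulr0 mul0r addr0.
Qed.

Lemma real_puiseux_mono q : real_puiseux (mono R[i] q).
Proof. by move=> p /=; case: (p == q). Qed.

End RealPuiseux.

(** * Vanishing minors are tropically singular *)

Section SymmetricMonomial.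
Variable k : nat.
Implicit Types s t : 'S_k.

Definition edge s (l : 'I_k) : 'I_k * 'I_k :=
  if (l <= s l)%N then (l, s l) else (s l, l).

Lemma sym_monomialE s p :
  sym_monomial s p = #|[pred l : 'I_k | edge s l == p]|.
Proof.
rewrite ffunE; apply: eq_card => l; rewrite [LHS]asboolb inE /edge.
by case: p => a b /=; case: leqP => _; rewrite xpair_eqE.
Qed.

Lemma sym_monomial_prod (K : comNzRingType) (x : 'M[K]_k) s : x^T = x ->
  \prod_l x l (s l) = \prod_p x p.1 p.2 ^+ sym_monomial s p.
Proof.
move=> symx; rewrite (partition_big (edge s) predT) //=.
apply: eq_bigr => p _; rewrite sym_monomialE -prodr_const.
apply: eq_bigr => l /eqP <-; rewrite /edge.
by case: leqP => //= _; rewrite -[in LHS]symx mxE.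
Qed.

Lemma sym_monomial_edge s t l : sym_monomial s = sym_monomial t ->
  exists l', edge t l' = edge s l.
Proof.
move=> /ffunP/(_ (edge s l)); rewrite !sym_monomialE => st.
have : (0 < #|[pred l' | edge t l' == edge s l]|)%N.
  by rewrite -st; apply/card_gt0P; exists l; rewrite inE /=.
by case/card_gt0P => l'; rewrite inE => /eqP; exists l'.
Qed.

(** The pair [{l, s l}] is also an edge of [t], so [t] sends [l] to [s l] or [s l] to [l]. *)
Lemma sym_monomial_mem_porbit s t l : sym_monomial s = sym_monomial t ->
  s l \in porbit t l.
Proof.
move=> /sym_monomial_edge-/(_ l)[l'].
have tP x : t x \in porbit t x by rewrite -[t x]/((t ^+ 1)%g x) mem_porbit.
have inv : t (s l) = l -> s l \in porbit t l.
  by move=> tsl; rewrite porbit_sym -[X in X \in _]tsl.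
rewrite /edge; case: leqP => _; case: leqP => _ [].
- by move=> <- <-.
- by move=> -> /inv.
- by move=> + E; rewrite E => /inv.
- by move=> <- <-.
Qed.

(* The monomial determines the cycles of the permutation up to orientation. *)
Lemma sym_monomial_odd s t : sym_monomial s = sym_monomial t ->
  odd_perm s = odd_perm t.
Proof.
have sub s' t' x : sym_monomial s' = sym_monomial t' ->
    {subset porbit s' x <= porbit t' x}.
  move=> st y /porbitP[i ->]; elim: i => [|i IH].
    by rewrite expg0 perm1 porbit_id.
  rewrite expgSr permM.
  have := sym_monomial_mem_porbit ((s' ^+ i)%g x) st.
  by move: IH; rewrite -!eq_porbit_mem => /eqP <-.
(* The sign depends only on [k] and on the number of cycles. *)
move=> st; rewrite /odd_perm; congr (_ (+) odd #|pred_of_set _|).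
apply: eq_imset => x; apply/setP => y.
by apply/idP/idP; exact: sub.
Qed.

End SymmetricMonomial.

(** * Lowest terms of determinants, and closedness of singularity *)

Section TropicalMinors.
Variable R : realType.
Implicit Types (k : nat).

(* Both notions of singularity in one: [key] is the identity for arbitrary
   matrices and [sym_monomial] for symmetric ones. *)
Definition singular_by (T : eqType) k (key : 'S_k -> T) (B : 'M[R]_k) : bool :=
  [exists s : 'S_k, exists t : 'S_k,
    [&& key s != key t, attains_min B s & attains_min B t]].

Lemma attains_minP k (B : 'M[R]_k) s :
  reflect (forall t, trop_weight B s <= trop_weight B t) (attains_min B s).
Proof. exact: forallP. Qed.

Lemma exists_attains_min k (B : 'M[R]_k) : exists s, attains_min B s.
Proof.
exists [arg min_(s < (1%g : 'S_k)) trop_weight B s]%O.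
by apply/attains_minP => t; case: arg_minP => // s _; apply.
Qed.

(** The permutations of least weight contribute to the lowest exponent of the determinant. If they
    all had one key, their signed leading coefficients would coincide, and a positive multiple of a
    nonzero number would vanish in characteristic zero. *)
Lemma singular_by_pval (T : eqType) k (key : 'S_k -> T)
    (x : 'M[puiseux R[i]]_k) :
    \det x = 0 -> (forall i j, x i j != 0) ->
    (forall s t, key s = key t -> odd_perm s = odd_perm t /\
       \prod_i x i (s i) = \prod_i x i (t i)) ->
  singular_by key (map_mx (fun a => ratr (pval a) : R) x).
Proof.
move=> detx x0 keyP; set B := map_mx _ x.
have [s smin] := exists_attains_min B.
apply: contraT => nsing.
have uniq t : attains_min B t -> key s = key t.
  move=> tmin; apply/eqP; apply: contraNT nsing => st.
  by apply/existsP; exists s; apply/existsP; exists t; apply/and3P.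
pose w (t : 'S_k) := \sum_i pval (x i (t i)).
pose c (t : 'S_k) := \prod_i pcoef (x i (t i)) (pval (x i (t i))).
have wE t : trop_weight B t = ratr (w t).
  by rewrite rmorph_sum /=; apply: eq_bigr => i _; rewrite mxE.
have P (t : {perm _}) : lead (\prod_i x i (t i)) (w t) (c t).
  by apply: lead_prod => i; exact: lead_pcoef.
have c0 t : c t != 0.
  by apply/prodf_neq0 => i _; have [] := pvalP (x0 i (t i)).
have wmin t : w s <= w t by rewrite -(ler_rat R) -!wE; exact: attains_minP.
have term (t : {perm _}) : lead ((-1) ^+ t * \prod_i x i (t i)) (w s)
    (if w t == w s then (-1) ^+ s * c s else 0).
  have [wts|wts] := eqVneq (w t) (w s); last first.
    rewrite -(mulr0 ((-1) ^+ t)); apply: lead_signM.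
    by apply: lead_lt (P t) _; rewrite lt_neqAle eq_sym wts wmin.
  have /uniq/keyP[-> <-] : attains_min B t.
    by apply/attains_minP => t'; rewrite !wE ler_rat wts wmin.
  exact: lead_signM.
have [detw _] : lead (\det x) (w s)
    (\sum_(t : 'S_k) if w t == w s then (-1) ^+ s * c s else 0).
  by rewrite /determinant; exact: lead_sum.
move: detw; rewrite detx -big_mkcond sumr_const -mulr_natr /= => /esym/eqP.
rewrite !mulf_eq0 signr_eq0 (negPf (c0 s)) pnatr_eq0 -leqn0 leqNgt /=.
by move=> /negP[]; apply/card_gt0P; exists s; rewrite unfold_in /= !eqxx.
Qed.

(** Nonsingularity is an open condition: a small perturbation of the entries cannot make a
    permutation with another key as light as the minimizer [s]. *)
Lemma singular_by_closed (T : eqType) k n (f g : 'I_k -> 'I_n)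
    (key : 'S_k -> T) (X : set 'M[R]_n) (A : 'M[R]_n) :
    (forall B, X B -> singular_by key (mxsub f g B)) -> closure X A ->
  singular_by key (mxsub f g A).
Proof.
move=> Xsing clA; have [s smin] := exists_attains_min (mxsub f g A).
apply: contraT => nsing.
pose W (s : 'S_k) (B : 'M[R]_n) := trop_weight (mxsub f g B) s.
pose e (t : 'S_k) := (W t A - W s A).
have key_lt t : key t != key s -> 0 < e t.
  move=> ts; rewrite subr_gt0 lt_neqAle (attains_minP _ _ smin) andbT.
  apply: contraNneq nsing => Wts; apply/existsP; exists t; apply/existsP.
  exists s; rewrite ts smin andbT /=; apply/attains_minP => t'.
  by rewrite -[trop_weight _ t]Wts; exact: attains_minP.
(* Moving the entries by less than [d] changes a difference of two weights by at most [2 * k * d],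
   which is below every gap [e t]. The default [1] serves when no other key exists, and [k.+1] keeps
   the divisor positive. *)
pose d := \big[Order.min/1]_(t | key t != key s) (e t / (2 * k.+1%:R)).
have k0 : 0 < 2 * k.+1%:R :> R by rewrite mulr_gt0.
have d0 : 0 < d.
  by apply: lt_bigmin => // t /key_lt et; rewrite divr_gt0.
have [B [/Xsing /existsP[t /existsP[t' /and3P[tt' tmin t'min]]] nearB]] :
    exists B, X B /\ forall i j, `|A i j - B i j| < d.
  have [|B [XB nB]] := clA (fun B => forall i j, `|A i j - B i j| < d).
    exists (fun i j => ball (A i j) d) => [i j|B AB i j]; last exact: AB.
    exact: nbhsx_ballx.
  by exists B.
have close u : `|W u A - W u B| <= k%:R * d.
  rewrite /W /trop_weight -sumrB (le_trans (ler_norm_sum _ _ _)) //.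
  rewrite -[X in X%:R * _]card_ord mulr_natl -sumr_const ler_sum // => i _.
  by rewrite !mxE ltW.
have absurd u : key u != key s -> attains_min (mxsub f g B) u -> False.
  move=> us /attains_minP/(_ s) umin.
  have ed : d * (2 * k.+1%:R) <= e u.
    by rewrite -ler_pdivlMr //; exact: bigmin_le_cond.
  have := close u; have := close s.
  rewrite !ler_norml => /andP[c1 c2] /andP[c3 c4].
  move: ed umin; rewrite -natr1 /e -/(W u B) -/(W s B) => ed umin.
  by lra.
have [keyts|] := eqVneq (key t) (key s); last by move=> /absurd/(_ tmin).
by case: (absurd t') => //; rewrite -keyts eq_sym.
Qed.

Lemma trop_singularE k (B : 'M[R]_k) : trop_singular B = singular_by id B.
Proof. by []. Qed.

Lemma trop_sym_singularE k (B : 'M[R]_k) :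
  trop_sym_singular B = singular_by (@sym_monomial k) B.
Proof. by []. Qed.

Lemma det_mxsub_rank (F : fieldType) m k (f g : 'I_k -> 'I_m) (x : 'M[F]_m) :
  (\rank x < k)%N -> \det (mxsub f g x) = 0.
Proof.
move=> xk; apply/eqP; apply: contraTT xk => d0; rewrite -leqNgt.
have /mxrank_unit rk : mxsub f g x \in unitmx by rewrite unitmxE unitfE.
rewrite -[leqLHS]rk (_ : mxsub f g x = rowsub f (colsub g x)); last first.
  by apply/matrixP => i j; rewrite !mxE.
rewrite (leq_trans (mxrankS (rowsub_sub _ _))) // -(mxrank_tr x) -mxrank_tr.
by rewrite trmx_mxsub mxrankS ?rowsub_sub.
Qed.

End TropicalMinors.

(** * Singular minors of tropicalized low-rank matrices *)

Section KapranovBound.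
Variable R : realType.

Lemma trop_sym_rank_singular (K : set (puiseux R[i])) n r k (A : 'M[R]_n) :
  trop K (@sym_rank_le R n r) A -> (r < k)%N -> ~~ has_nonsingular_submx A k.
Proof.
move=> tropA rk; apply/existsP => -[f /existsP[g /and3P[_ _]]].
(* Principal and nonprincipal minors differ only in the key, which has to determine each term of the
   determinant together with its sign. *)
suff sing (T : eqType) (key : 'S_k -> T) :
    (forall x : 'M[puiseux R[i]]_n, x^T = x -> forall s t, key s = key t ->
       odd_perm s = odd_perm t /\
       \prod_i x (f i) (g (s i)) = \prod_i x (f i) (g (t i))) ->
    singular_by key (mxsub f g A).
  have [fg|_] := eqVneq f g; apply/negP; rewrite negbK.
    rewrite trop_sym_singularE; apply: sing => x symx s t st.
    split; first exact: sym_monomial_odd.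
    have symfx : (mxsub f f x)^T = mxsub f f x by rewrite trmx_mxsub symx.
    transitivity (\prod_i mxsub f f x i (s i)).
      by apply: eq_bigr => i _; rewrite mxE fg.
    rewrite sym_monomial_prod // st -sym_monomial_prod //.
    by apply: eq_bigr => i _; rewrite mxE fg.
  by rewrite trop_singularE; apply: sing => x _ s t ->.
move=> keyP; apply: singular_by_closed tropA => _ [x [[symx rkx] x0] <-].
rewrite -map_mxsub; apply: singular_by_pval.
- by apply: det_mxsub_rank; exact: leq_ltn_trans rkx rk.
- by move=> i j; rewrite mxE; have [] := x0 (f i) (g j).
move=> s t /(keyP x symx)[? pst]; split=> //.
under eq_bigr do rewrite mxE.
by rewrite pst; apply: eq_bigr => i _; rewrite mxE.
Qed.

Lemma increasing_leq k n (f : {ffun 'I_k -> 'I_n}) : increasing f -> (k <= n)%N.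
Proof.
move=> /'forall_'forall_implyP incf.
rewrite -[k]card_ord -[n]card_ord; apply: (@leq_card _ _ f) => i j fij.
by apply/val_inj; case: (ltngtP i j) => // /incf; rewrite fij ltnn.
Qed.

(** A square submatrix has at most [n] rows, so the bounded maximum covers all possible sizes. *)
Lemma symmetric_tropical_rank_eq2 n (A : 'M[R]_n) :
  symmetric_tropical_rank A = 2%N <-> has_nonsingular_submx A 2 /\
    forall k, (2 < k)%N -> ~~ has_nonsingular_submx A k.
Proof.
have kn k : has_nonsingular_submx A k -> (k < n.+1)%N.
  by case/existsP=> f /existsP[g /and3P[/increasing_leq]].
rewrite /symmetric_tropical_rank; split=> [rk|[has2 no]].
  have max k : has_nonsingular_submx A k -> (k <= 2)%N.
    move=> hask; rewrite -rk; pose i := Ordinal (kn k hask).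
    by rewrite -[k]/(val i); apply: leq_bigmax_cond.
  split; last by move=> k lt2k; apply: contraTN lt2k => /max; rewrite -leqNgt.
  apply: contraT => no2.
  suff : (\max_(k < n.+1 | has_nonsingular_submx A k) k <= 1)%N by rewrite rk.
  apply/bigmax_leqP => k hask; have := max _ hask; rewrite leq_eqVlt ltnS.
  by case/predU1P => // k2; move: no2; rewrite -k2 hask.
apply/eqP; rewrite eqn_leq; apply/andP; split.
  apply/bigmax_leqP => k; apply: contraTT; rewrite -ltnNge; exact: no.
exact: (@leq_bigmax_cond _ _ _ (Ordinal (kn _ has2))).
Qed.

(** * Rational approximation and the lift to rank one *)

Lemma closure_mxP m n (X : set 'M[R]_(m, n)) (A : 'M[R]_(m, n)) :
  (forall e, 0 < e -> exists2 B, X B & forall i j, `|A i j - B i j| < e) ->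
  closure X A.
Proof.
move=> approx U /nbhs_ballP[e /= e0 AU].
by have [B XB AB] := approx _ e0; exists B; split=> //; apply: AU.
Qed.

Definition round N (x : R) : rat := (Num.floor (N.+1%:R * x))%:~R / N.+1%:R.

Lemma round_close N (x : R) : `|x - ratr (round N x)| < N.+1%:R^-1.
Proof.
have N0 : 0 < N.+1%:R :> R by rewrite ltr0n.
have /andP[lo hi] := floor_itv (N.+1%:R * x).
rewrite fmorph_div /= ratr_int ratr_nat -[x in x - _](mulKf (lt0r_neq0 N0)).
rewrite [X in X - _]mulrC -mulrBl normrM normfV (gtr0_norm N0).
rewrite -ltr_pdivlMr ?invr_gt0 // divff ?invr_neq0 ?lt0r_neq0 //.
by rewrite ger0_norm ?subr_ge0 // ltrBlDl -[1]/(1%:~R) -intrD.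
Qed.

Lemma exists_round (e : R) : 0 < e -> exists N, N.+1%:R^-1 < e :> R.
Proof.
move=> e0; exists (Num.truncn e^-1).
by rewrite -[ltRHS]invrK ltf_pV2 ?posrE ?invr_gt0 ?ltr0n // truncnS_gt.
Qed.

(** With [v i = t^(A i i / 2)], exponents rounded to rationals, the matrix [v v^T] has rank at most
    one and valuations close to [A]. *)
Lemma trop_sym_rank1 n (A : 'M[R]_n) :
  (forall i j, A i j = (A i i + A j j) / 2) ->
  trop (@real_puiseux R) (@sym_rank_le R n 1) A.
Proof.
move=> Ahalf; apply: closure_mxP => e e0.
have [N Ne] := exists_round (divr_gt0 e0 (ltr0n R 2)).
pose u i := round N (A i i / 2).
pose v : 'cV[puiseux R[i]]_n := \col_i mono _ (u i).
have vE i j : (v *m v^T) i j = mono _ (u i + u j).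
  by rewrite mxE big_ord1 !mxE monoD.
have vval i j : (v *m v^T) i j != 0 /\ pval ((v *m v^T) i j) = u i + u j.
  by rewrite vE; apply: lead_pval (lead_mono _ _) _; rewrite oner_neq0.
eexists; first exists (v *m v^T); first split=> [|i j].
- by rewrite /sym_rank_le /= trmx_mul trmxK mulmx_max_rank.
- rewrite [X in real_puiseux X]vE; split; last by have [] := vval i j.
  exact: real_puiseux_mono.
- by [].
move=> i j; rewrite mxE (vval i j).2 Ahalf rmorphD mulrDl opprD addrACA.
rewrite (le_lt_trans (ler_normD _ _)) // [e]splitr ltrD //.
  by rewrite (lt_trans (round_close _ _)).
by rewrite (lt_trans (round_close _ _)).
Qed.

Lemma ord2P (P : 'I_2 -> Prop) : P 0 -> P 1 -> forall i, P i.
Proof.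
by move=> P0 P1 [[|[|//]] lti]; [move: P0|move: P1]; congr P; exact: val_inj.
Qed.

(** The principal minor on [i] and [j] has only the monomials [a_ii a_jj] and [a_ij^2], so these two
    must tie. *)
Lemma singular2_half n (A : 'M[R]_n) : A^T = A ->
  ~~ has_nonsingular_submx A 2 -> forall i j, A i j = (A i i + A j j) / 2.
Proof.
move=> symA no2; have AC i j : A i j = A j i by rewrite -[in LHS]symA mxE.
move=> i j; wlog lt_ij : i j / (i < j)%N => [W|].
  have [/W //|/W E|/val_inj ->] := ltngtP i j; last by lra.
  by rewrite AC E [_ + A i i]addrC.
pose f : {ffun 'I_2 -> 'I_n} := [ffun a => if a == 0 then i else j].
have incf : increasing f.
  by apply/'forall_'forall_implyP; elim/ord2P; elim/ord2P; rewrite !ffunE.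
move: no2 => /existsPn/(_ f)/existsPn/(_ f); rewrite incf eqxx negbK /=.
have s01 (s : 'S_2) : s 0 = 0 /\ s 1 = 1 \/ s 0 = 1 /\ s 1 = 0.
  have := inj_eq (@perm_inj _ s) 0 1.
  by elim/ord2P: (s 0); elim/ord2P: (s 1) => //; [left|right].
have W (s : 'S_2) : trop_weight (mxsub f f A) s =
    if s 0 == 0 then A i i + A j j else A i j + A i j.
  rewrite /trop_weight big_ord_recl big_ord1 !mxE !ffunE.
  rewrite (_ : lift ord0 ord0 = 1 :> 'I_2); last exact: val_inj.
  by have [[-> ->]|[-> ->]] := s01 s; rewrite //= (AC j i).
move=> /existsP[s /existsP[t /and3P[st /attains_minP smin /attains_minP tmin]]].
move: (smin t) (tmin s); rewrite !W.
have ne : (s 0 == 0) != (t 0 == 0).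
  apply: contraNneq st => e0; rewrite (_ : s = t) //; apply/permP.
  move: e0; have [[s0 s1]|[s0 s1]] := s01 s; have [[t0 t1]|[t0 t1]] := s01 t;
    rewrite s0 t0 // => _; elim/ord2P; by rewrite ?s0 ?s1 ?t0 ?t1.
by move: ne; case: (s 0 == 0); case: (t 0 == 0) => // _; lra.
Qed.

End KapranovBound.

(** * Singular 3x3 minors *)

Section Minors3.
Variable R : realType.

Let i0 : 'I_3 := @Ordinal 3 0 isT.
Let i1 : 'I_3 := @Ordinal 3 1 isT.
Let i2 : 'I_3 := @Ordinal 3 2 isT.

Lemma ord3P (P : 'I_3 -> Prop) : P i0 -> P i1 -> P i2 -> forall i, P i.
Proof.
by move=> P0 P1 P2 [[|[|[|//]]] lti]; [move: P0|move: P1|move: P2];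
  congr P; exact: val_inj.
Qed.

Lemma perm3P (s : 'S_3) : (s i0, s i1, s i2) \in
  [:: (i0, i1, i2); (i0, i2, i1); (i2, i1, i0);
      (i1, i0, i2); (i1, i2, i0); (i2, i0, i1)].
Proof.
have := inj_eq (@perm_inj _ s) i0 i1; have := inj_eq (@perm_inj _ s) i0 i2.
have := inj_eq (@perm_inj _ s) i1 i2.
by elim/ord3P: (s i0); elim/ord3P: (s i1); elim/ord3P: (s i2).
Qed.

Lemma perm3_ex (a b c : 'I_3) : uniq [:: a; b; c] ->
  exists s : 'S_3, [/\ s i0 = a, s i1 = b & s i2 = c].
Proof.
move=> abc; have inj : injective (fun i : 'I_3 => nth a [:: a; b; c] i).
  by move=> i j /eqP; rewrite nth_uniq // => /eqP/val_inj.
by exists (perm inj); rewrite !permE.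
Qed.

Lemma trop_weight3 (B : 'M[R]_3) (s : 'S_3) :
  trop_weight B s = B i0 (s i0) + B i1 (s i1) + B i2 (s i2).
Proof.
rewrite /trop_weight !big_ord_recl big_ord0 addr0 addrA.
by congr (B _ (s _) + B _ (s _) + B _ (s _)); exact: val_inj.
Qed.

Lemma attains_min3 (B : 'M[R]_3) (s : 'S_3) (a b c : 'I_3) : attains_min B s ->
  uniq [:: a; b; c] -> trop_weight B s <= B i0 a + B i1 b + B i2 c.
Proof.
move=> /attains_minP smin /perm3_ex[t [<- <- <-]].
by rewrite -trop_weight3.
Qed.

Lemma trop_singular3_diag (B : 'M[R]_3) : trop_singular B ->
  let d := B i0 i0 + B i1 i1 + B i2 i2 in
  ~ [/\ d < B i0 i0 + B i1 i2 + B i2 i1, d < B i0 i2 + B i1 i1 + B i2 i0,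
        d < B i0 i1 + B i1 i0 + B i2 i2, d < B i0 i1 + B i1 i2 + B i2 i0
      & d < B i0 i2 + B i1 i0 + B i2 i1].
Proof.
move=> /existsP[s /existsP[t /and3P[st smin tmin]]] d [d1 d2 d3 d4 d5].
have only1 u : attains_min B u -> u = 1%g.
  move=> umin; have := attains_min3 umin (isT : uniq [:: i0; i1; i2]).
  rewrite -/d trop_weight3; have := perm3P u; rewrite !inE.
  case/or4P=> [/eqP[u0 u1 u2]|/eqP[-> -> ->]|/eqP[-> -> ->]|]; last first.
  - by case/or3P=> /eqP[-> -> ->]; rewrite leNgt ?d3 ?d4 ?d5.
  - by rewrite leNgt d2.
  - by rewrite leNgt d1.
  by move=> _; apply/permP; elim/ord3P; rewrite perm1.
by move: st; rewrite (only1 s) // (only1 t) // eqxx.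
Qed.

Lemma perm3_ext (s t : 'S_3) :
  (s i0, s i1, s i2) = (t i0, t i1, t i2) -> s = t.
Proof. by case=> st0 st1 st2; apply/permP; elim/ord3P. Qed.

(** Reindexing by [s] reverses each edge, which leaves the unordered pair unchanged. *)
Lemma sym_monomialV k (s : 'S_k) : sym_monomial s^-1%g = sym_monomial s.
Proof.
apply/ffunP => p; rewrite !sym_monomialE -!sum1_card.
rewrite (reindex_inj (@perm_inj _ s)); apply: eq_bigl => l.
by rewrite !inE /edge permK; case: ltngtP => // /val_inj ->.
Qed.

(* The tie pattern of the five monomials of a symmetric 3x3 determinant, after
   scaling the diagonal to zero; [x], [y], [z] are twice the off-diagonal
   entries. *)
Definition tie5 (x y z : R) : Prop :=
  let v := [:: 0; x; y; z; (x + y + z) / 2] in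
  exists p q, [/\ (p < 5)%N, (q < 5)%N, p != q,
                  all (>= v`_p) v & all (>= v`_q) v].

Lemma trop_sym_singular3 (B : 'M[R]_3) : B^T = B -> trop_sym_singular B ->
  tie5 (2 * B i1 i2 - B i1 i1 - B i2 i2) (2 * B i0 i2 - B i0 i0 - B i2 i2)
       (2 * B i0 i1 - B i0 i0 - B i1 i1).
Proof.
move=> symB /existsP[s /existsP[t /and3P[st smin tmin]]].
have [B21 B20 B10] :
    [/\ B i2 i1 = B i1 i2, B i2 i0 = B i0 i2 & B i1 i0 = B i0 i1].
  by split; rewrite -[in LHS]symB mxE.
(* The identity comes first, then the three transpositions in the order of [x], [y], [z], then the
   two 3-cycles at positions 4 and 5. The latter are mutually inverse and share a monomial, so
   [minn _ 4] merges them. *)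
pose L : seq ('I_3 * 'I_3 * 'I_3) := [:: (i0, i1, i2); (i0, i2, i1);
  (i2, i1, i0); (i1, i0, i2); (i1, i2, i0); (i2, i0, i1)].
pose idx (u : 'S_3) := index (u i0, u i1, u i2) L.
have idx6 (u : 'S_3) : (idx u < 6)%N by rewrite index_mem perm3P.
have idxE (u : 'S_3) : (u i0, u i1, u i2) = nth (i0, i0, i0) L (idx u).
  by rewrite nth_index ?perm3P.
set x := 2 * _ - _ - _; set y := 2 * _ - _ - _; set z := 2 * _ - _ - _.
pose v := [:: 0; x; y; z; (x + y + z) / 2].
pose tr := B i0 i0 + B i1 i1 + B i2 i2.
have WE (u : 'S_3) : trop_weight B u = tr + v`_(minn (idx u) 4).
  move: (idxE u) (idx6 u); rewrite trop_weight3 /tr.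
  by case: (idx u) => [|[|[|[|[|[|//]]]]]] [-> -> ->] _;
    rewrite /= /x /y /z ?B21 ?B20 ?B10; lra.
have vmin (u : 'S_3) : attains_min B u -> all (>= v`_(minn (idx u) 4)) v.
  move=> umin; have W a b c := attains_min3 (a := a) (b := b) (c := c) umin.
  have /= := (W i0 i1 i2 isT, W i0 i2 i1 isT, W i2 i1 i0 isT, W i1 i0 i2 isT,
              W i1 i2 i0 isT).
  rewrite WE /tr ?B21 ?B20 ?B10; move: v`_(minn _ _) => m [[[[]]]] *.
  by apply/and5P; split; rewrite ?andbT /x /y /z; lra.
exists (minn (idx s) 4), (minn (idx t) 4).
split; [lia..| |exact: vmin|exact: vmin].
apply: contraNneq st => sti.
have conj (u u' : 'S_3) : idx u = 4 -> idx u' = 5 -> u' = (u^-1)%g.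
  move=> u4 u5; apply/permP => i; apply: (@perm_inj _ u); rewrite permKV.
  move: (idxE u) (idxE u'); rewrite u4 u5 /= => -[a0 a1 a2] [b0 b1 b2].
  by move: i; elim/ord3P; rewrite ?b0 ?b1 ?b2.
have [sti'|] := eqVneq (idx s) (idx t).
  by rewrite (@perm3_ext s t) // !idxE sti'.
move: (idx6 s) (idx6 t) => s6 t6 nst.
have [[s4 t5]|[s5 t4]] :
    idx s = 4%N /\ idx t = 5%N \/ idx s = 5%N /\ idx t = 4%N.
- by lia.
- by rewrite (conj s t) // sym_monomialV.
- by rewrite (conj t s) // sym_monomialV.
Qed.

(* The numbers [e x], [e y], [e z] are the distances between three points of a
   line. *)
Definition collinear (x y z : R) : Prop :=
  let e a := Num.max 0 (- a) in
  [\/ e x = e y + e z, e y = e x + e z | e z = e x + e y].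

(** A minimum at [0] makes [x], [y], [z] nonnegative; a tie of two among [x], [y], [z] makes the
    third nonnegative; a tie of [x] with the half-sum gives [x = y + z] with [y] and [z]
    nonpositive. *)
Lemma tie5_collinear x y z : tie5 x y z -> collinear x y z.
Proof.
move=> [p [q [p5 q5 pq]]]; rewrite /collinear.
move: p5 q5 pq.
case: p => [|[|[|[|[|//]]]]] _; case: q => [|[|[|[|[|//]]]]] //= _ _;
  move=> /and5P[h1 h2 h3 h4 /andP[h5 _]] /and5P[k1 k2 k3 k4 /andP[k5 _]];
  case: (leP 0 (- x)) => ?; case: (leP 0 (- y)) => ?; case: (leP 0 (- z)) => ?;
  (try by apply: Or31; lra); (try by apply: Or32; lra); by apply: Or33; lra.
Qed.

(** Otherwise [0] would be strictly the least of the five values. *)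
Lemma tie5_npos x y z : tie5 x y z -> ~ [/\ 0 < x, 0 < y & 0 < z].
Proof.
move=> [p [q [p5 q5 pq]]] + + [x0 y0 z0].
move: p5 q5 pq.
case: p => [|[|[|[|[|//]]]]] _; case: q => [|[|[|[|[|//]]]]] //= _ _;
  move=> /and5P[h1 h2 h3 h4 /andP[h5 _]] /and5P[k1 k2 k3 k4 /andP[k5 _]]; lra.
Qed.

Lemma increasing3 n (f : 'I_3 -> 'I_n) :
  (f i0 < f i1)%N -> (f i1 < f i2)%N -> increasing [ffun i => f i].
Proof.
move=> f01 f12; apply/'forall_'forall_implyP; elim/ord3P; elim/ord3P => // _.
- by rewrite !ffunE.
- by rewrite !ffunE (ltn_trans f01).
- by rewrite !ffunE.
Qed.

(** This allows the rows and columns of a minor to be listed in any order, although submatrices are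
    selected by increasing maps. *)
Lemma sort3 n (f : 'I_3 -> 'I_n) : injective f ->
  exists s : 'S_3, increasing [ffun i => f (s i)].
Proof.
move=> injf; have lt a b : a != b -> (f a < f b)%N \/ (f b < f a)%N.
  rewrite -(inj_eq injf) -val_eqE neq_ltn => /orP[]; tauto.
have S a b c : uniq [:: a; b; c] -> (f a < f b)%N -> (f b < f c)%N ->
    exists s : 'S_3, increasing [ffun i => f (s i)].
  move=> /perm3_ex[s [<- <- <-]] ab bc; exists s.
  exact: (@increasing3 _ (f \o s)).
have [ab|ab] := lt i0 i1 isT; have [bc|bc] := lt i1 i2 isT;
  have [ac|ac] := lt i0 i2 isT.
- exact: (S i0 i1 i2).
- lia.
- exact: (S i0 i2 i1).
- exact: (S i2 i0 i1).
- exact: (S i1 i0 i2).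
- exact: (S i1 i2 i0).
- lia.
- exact: (S i2 i1 i0).
Qed.

End Minors3.

(** * Metric structure forced by singular 3x3 minors *)

Section NoMinor3.
Variables (R : realType) (n : nat) (A : 'M[R]_n).
Hypotheses (symA : A^T = A) (no3 : ~~ has_nonsingular_submx A 3).

Let AC i j : A i j = A j i.
Proof. by rewrite -[in LHS]symA mxE. Qed.

(** Permuting rows by [p] and columns by [q] carries [s] to [p^-1 * s * q], a bijection that
    preserves weights. *)
Lemma trop_singular_perm k m (f g : 'I_k -> 'I_m) (p q : 'S_k) (B : 'M[R]_m) :
  trop_singular (mxsub (f \o p) (g \o q) B) -> trop_singular (mxsub f g B).
Proof.
have WE s : trop_weight (mxsub (f \o p) (g \o q) B) s =
            trop_weight (mxsub f g B) (p^-1 * s * q)%g.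
  rewrite /trop_weight [RHS](reindex_inj (@perm_inj _ p)).
  by apply: eq_bigr => i _; rewrite !mxE !permM permK.
have min s : attains_min (mxsub (f \o p) (g \o q) B) s ->
             attains_min (mxsub f g B) (p^-1 * s * q)%g.
  move=> /attains_minP smin; apply/attains_minP => t.
  have := smin (p * t * q^-1)%g; rewrite !WE.
  by rewrite -!mulgA mulVg mulg1 mulKg !mulgA.
move=> /existsP[s /existsP[t /and3P[st /min smin /min tmin]]].
apply/existsP; exists (p^-1 * s * q)%g; apply/existsP.
exists (p^-1 * t * q)%g; rewrite smin tmin !andbT.
by rewrite (inj_eq (mulIg _)) (inj_eq (mulgI _)).
Qed.

Lemma trop_singular_nonprincipal (f g : 'I_3 -> 'I_n) :
  injective f -> injective g -> (exists i, forall j, g j != f i) ->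
  trop_singular (mxsub f g A).
Proof.
move=> /sort3[p incp] /sort3[q incq] [i fi].
apply: (@trop_singular_perm _ _ f g p q).
have /existsPn/(_ [ffun i => f (p i)])/existsPn/(_ [ffun i => g (q i)]) := no3.
rewrite incp incq /=; case: eqP => [/ffunP/(_ (p^-1 i)%g)|_].
  by rewrite !ffunE permKV => /eqP; rewrite eq_sym (negPf (fi _)).
rewrite negbK; congr (is_true (trop_singular _)).
by apply/matrixP => a b; rewrite !mxE !ffunE.
Qed.

Lemma nonprincipal_minor3 a b c d e h :
  uniq [:: a; b; c] -> uniq [:: d; e; h] -> a \notin [:: d; e; h] ->
  let m := A a d + A b e + A c h in
  ~ [/\ m < A a d + A b h + A c e, m < A a h + A b e + A c d,
        m < A a e + A b d + A c h, m < A a e + A b h + A c d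
      & m < A a h + A b d + A c e].
Proof.
pose f u v w (i : 'I_3) : 'I_n := nth u [:: u; v; w] i.
have finj u v w : uniq [:: u; v; w] -> injective (f u v w).
  by move=> uvw i j /eqP; rewrite nth_uniq // => /eqP/val_inj.
move=> abc deh ad.
have /trop_singular3_diag : trop_singular (mxsub (f a b c) (f d e h) A).
  apply: trop_singular_nonprincipal; [exact: finj..|exists ord0 => j].
  by apply: contraNneq ad => E; rewrite -[a]/(f a b c ord0) -E mem_nth.
by rewrite !mxE.
Qed.

(** Twice the entry after the symmetric tropical scaling that makes the diagonal zero. *)
Definition offset i j : R := 2 * A i j - A i i - A j j.

Lemma offsetC i j : offset i j = offset j i.
Proof. by rewrite /offset AC; ring. Qed.

Lemma offsetii i : offset i i = 0.
Proof. by rewrite /offset; ring. Qed.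

Lemma offset_tie5 (i j k : 'I_n) : (i < j < k)%N ->
  tie5 (offset j k) (offset i k) (offset i j).
Proof.
move=> /andP[ij jk]; pose f (l : 'I_3) : 'I_n := nth i [:: i; j; k] l.
have incf : increasing [ffun l => f l] by exact: increasing3.
have /existsPn/(_ [ffun l => f l])/existsPn/(_ [ffun l => f l]) := no3.
rewrite incf eqxx /= negbK => /trop_sym_singular3.
by rewrite trmx_mxsub symA !mxE !ffunE; apply.
Qed.

(** Adjacent swaps reduce to increasing indices. When two indices coincide, one offset is [0] and
    the other two agree, whence the case [P x x 0]. *)
Lemma offset_sort (P : R -> R -> R -> Prop) (i j k : 'I_n) :
  (forall x y z, P x y z -> P y x z) -> (forall x y z, P x y z -> P x z y) ->
  (forall x, P x x 0) -> (forall x y z, tie5 x y z -> P x y z) ->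
  P (offset j k) (offset i k) (offset i j).
Proof.
move=> P12 P23 P0 Ptie.
have sorted (a b c : 'I_n) : (a < b < c)%N ->
    P (offset b c) (offset a c) (offset a b).
  by move=> /offset_tie5/Ptie.
have [ij|ji|/val_inj ->] := ltngtP i j; last by rewrite offsetii.
- have [ik|ki|/val_inj ->] := ltngtP i k.
  + have [jk|kj|/val_inj ->] := ltngtP j k.
    * by apply: sorted; rewrite ij.
    * by rewrite (offsetC j k); apply/P23/sorted; rewrite ik.
    * by rewrite offsetii; apply/P12/P23/P12.
  + rewrite (offsetC i k) (offsetC j k).
    by apply/P23/P12/sorted; rewrite ki.
  + by rewrite offsetii (offsetC k j); apply/P23.
- rewrite (offsetC i j); have [ik|ki|/val_inj ->] := ltngtP i k.
  + by apply/P12/sorted; rewrite ji.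
  + have [jk|kj|/val_inj ->] := ltngtP j k.
    * by rewrite (offsetC i k); apply/P12/P23/sorted; rewrite jk.
    * rewrite (offsetC i k) (offsetC j k).
      by apply/P12/P23/P12/sorted; rewrite kj.
    * by rewrite offsetii (offsetC k i); apply/P12/P23/P12.
  + by rewrite offsetii; apply/P23.
Qed.

(** The graph of pairs with positive offset is thus triangle-free. *)
Lemma offset_npos i j k :
  ~ [/\ 0 < offset j k, 0 < offset i k & 0 < offset i j].
Proof.
apply: (@offset_sort (fun x y z => ~ [/\ 0 < x, 0 < y & 0 < z])).
- by move=> x y z H [x0 y0 z0]; apply: H.
- by move=> x y z H [x0 y0 z0]; apply: H.
- by move=> x []; rewrite ltxx.
- exact: tie5_npos.
Qed.

Definition sep i j : R := Num.max 0 (- offset i j).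

Lemma sepC i j : sep i j = sep j i.
Proof. by rewrite /sep offsetC. Qed.

Lemma sepii i : sep i i = 0.
Proof. by rewrite /sep offsetii oppr0 maxxx. Qed.

Lemma sep_ge0 i j : 0 <= sep i j.
Proof. by rewrite le_max lexx. Qed.

Lemma sep_collinear i j k :
  [\/ sep i j = sep i k + sep k j, sep i k = sep i j + sep j k
    | sep j k = sep i j + sep i k].
Proof.
have : collinear (offset j k) (offset i k) (offset i j).
  apply: (@offset_sort (@collinear R) i j k) => [x y z|x y z|x|x y z].
  - by rewrite /collinear [_ (- x) + _ (- y)]addrC => -[];
      [apply: Or32|apply: Or31|apply: Or33].
  - by rewrite /collinear [_ (- y) + _ (- z)]addrC => -[];
      [apply: Or31|apply: Or33|apply: Or32].
  - by rewrite /collinear oppr0 maxxx addr0; apply: Or31.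
  - exact: tie5_collinear.
rewrite /collinear -/(sep j k) -/(sep i k) -/(sep i j) (sepC k j).
case=> ->; [apply: Or33|apply: Or32|apply: Or31]; lra.
Qed.

(* A metric space all of whose triples are collinear is collinear, except for
   the four-point "pseudo-linear" spaces with opposite sides equal, and those
   are ruled out by a nonprincipal minor. *)
Lemma sep_line : exists z : 'I_n -> R, forall i j, sep i j = `|z i - z j|.
Proof.
have [n0|[i0]] : n = 0%N \/ exists i : 'I_n, True.
- by case: (n) => [|m]; [left|right; exists ord0].
- by exists (fun=> 0) => -[i lti]; exfalso; move: lti; rewrite n0.
(* Positions on the line are distances from one end [a] of a farthest pair; by maximality every
   point then lies between [a] and [b]. *)
move=> _; have [[a b] _ /= maxab] :=
  @arg_maxP _ R _ (i0, i0) xpredT (fun p => sep p.1 p.2) isT.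
exists (sep a) => x y.
have max u v : sep u v <= sep a b by exact: (maxab (u, v)).
have split u : sep a b = sep a u + sep u b.
  have := max a u; have := max u b; have := max a b.
  have := sep_ge0 a u; have := sep_ge0 u b.
  by have := sepC b u; case: (sep_collinear a b u); lra.
have : sep x y = `|sep a x - sep a y| \/ [/\ sep x y = sep a b,
    sep a y = sep b x, sep a x = sep b y, 0 < sep a x & 0 < sep a y].
  have := sep_collinear a x y; have := sep_collinear b x y.
  rewrite !(sepC y x); have := split x; have := split y.
  rewrite (sepC x b) (sepC y b).
  have := (sep_ge0 a x, sep_ge0 a y, sep_ge0 b x, sep_ge0 b y, sep_ge0 x y).
  move=> [[[[]]]].
  move: (sep x y) (sep a x) (sep a y) (sep b x) (sep b y) (sep a b).
  move=> xy ax ay bx by_ ab.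
  move=> h1 h2 h3 h4 h5 e1 e2 c1 c2.
  have [ax0|ax0] := leP ax 0.
    by left; case: ger0P; case: c1; case: c2; lra.
  have [ay0|ay0] := leP ay 0.
    by left; case: ger0P; case: c1; case: c2; lra.
  have [xyE|xyE] : xy = `|ax - ay| \/ xy = ax + ay.
  - by case: c2 => ?; [left; case: ger0P|left; case: ger0P|right]; lra.
  - by left.
  case: c1 => c1; [left; case: ger0P|left; case: ger0P|right; split]; lra.
case=> // -[xyab aybx axby ax0 ay0].
have abE := split x; rewrite (sepC x b) -aybx in abE.
have sepE u v : 0 < sep u v -> offset u v = - sep u v /\ u != v.
  rewrite /sep; have [_ lt0|_] := leP 0 (- offset u v); last by rewrite ltxx.
  rewrite opprK.
  split=> //; by apply: contraTneq lt0 => ->; rewrite offsetii oppr0 ltxx.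
have [oax ax] := sepE _ _ ax0; have [oay ay] := sepE _ _ ay0.
have [|oab ab] := sepE a b; first by lra.
have [|oxy xy] := sepE x y; first by lra.
have [|obx bx] := sepE b x; first by lra.
have [|oby b_y] := sepE b y; first by lra.
(* With columns [a], [x], [y] the diagonal collects the two longest pairs, [a b] and [x y], and the
   pair [a x]; its sum is strictly below all others. *)
have /nonprincipal_minor3 : uniq [:: b; a; x].
  by rewrite /= !inE negb_or bx ax eq_sym ab.
case/(_ a x y).
- by rewrite /= !inE negb_or ax ay xy.
- by rewrite !inE !negb_or bx b_y eq_sym ab.
move: oax oay oab oxy obx oby; rewrite /offset -aybx -axby xyab abE.
rewrite (AC b a) (AC x a) => *; split; lra.
Qed.

Definition height i j : R := Num.max 0 (offset i j).

Lemma heightC i j : height i j = height j i.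
Proof. by rewrite /height offsetC. Qed.

Lemma heightii i : height i i = 0.
Proof. by rewrite /height offsetii maxxx. Qed.

Lemma height_ge0 i j : 0 <= height i j.
Proof. by rewrite le_max lexx. Qed.

(** Otherwise the offsets of [i l], [k l], [k j] all exceed [height i j]. Triangle-freeness and
    transitivity of zero separation give offset zero to [i k] and [l j]. Then the diagonal is the
    unique minimum in the minor with rows [i], [k], [l] and columns [j], [k], [l]. *)
Lemma height_path i j k l :
  Num.min (height i l) (Num.min (height k l) (height k j)) <= height i j.
Proof.
rewrite leNgt !lt_min; apply/negP => /and3P[il kl kj].
have hE u v : height i j < height u v -> offset u v = height u v /\ u != v.
  move=> lt_ij; have h0 := le_lt_trans (height_ge0 i j) lt_ij; split.
    move: h0; rewrite /height.
    by have [//|_] := leP 0 (offset u v); rewrite ltxx.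
  by apply: contraTneq h0 => ->; rewrite heightii ltxx.
have [oil il'] := hE _ _ il; have [okl kl'] := hE _ _ kl.
have [okj kj'] := hE _ _ kj; have ij0 := height_ge0 i j.
have sep0 u v : 0 < offset u v -> sep u v = 0.
  by move=> uv; apply/max_idPl; lra.
have sep0_trans u v w : sep u v = 0 -> sep v w = 0 -> sep u w = 0.
  have := sep_collinear u w v; rewrite (sepC w v).
  by have := (sep_ge0 u v, sep_ge0 u w, sep_ge0 v w) => -[[? ?] ?] []; lra.
have offset_ge0 u v : sep u v = 0 -> 0 <= offset u v.
  by move=> /max_idPl; lra.
have npos u v w : 0 < offset u v -> 0 < offset v w -> offset u w <= 0.
  move=> uv vw; rewrite leNgt; apply/negP => uw.
  by apply: (@offset_npos u v w); rewrite vw uw uv.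
(* If [i = j], the three edges form a forbidden triangle. *)
have [eq_ij|ij] := eqVneq i j.
  have : offset k i <= 0 by apply: (npos k l i); rewrite ?(offsetC l i); lra.
  by rewrite eq_ij; lra.
have ik : i != k by apply: contraTneq kj => <-; rewrite ltxx.
have lj : l != j by apply: contraTneq il => ->; rewrite ltxx.
have oil0 : 0 < offset i l by lra.
have okl0 : 0 < offset k l by lra.
have okj0 : 0 < offset k j by lra.
have sik : sep i k = 0.
  by apply: (sep0_trans i l k); rewrite ?(sepC l k); exact: sep0.
have slj : sep l j = 0.
  by apply: (sep0_trans l k j); rewrite ?(sepC l k); exact: sep0.
have sij : sep i j = 0 by apply: (sep0_trans i k j) => //; exact: sep0.
have := (offset_ge0 _ _ sik, offset_ge0 _ _ slj, offset_ge0 _ _ sij).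
have oik : offset i k <= 0 by apply: (npos i l k); rewrite // offsetC.
have olj : offset l j <= 0 by apply: (npos l k j); rewrite // offsetC.
have oij : offset i j <= height i j by rewrite le_max lexx orbT.
case=> -[oik' olj'] oij'.
have /nonprincipal_minor3 : uniq [:: i; k; l].
  by rewrite /= !inE negb_or ik il' kl'.
case/(_ j k l).
- by rewrite /= !inE negb_or (eq_sym j k) (eq_sym j l) kj' lj kl'.
- by rewrite !inE !negb_or ij ik il'.
move: il kl kj oil okl okj.
move: (height i l) (height k l) (height k j) => hil hkl hkj.
move: oik olj oij oik' olj' oij'; rewrite /offset (AC l k) (AC l j).
by move=> *; split; lra.
Qed.


End NoMinor3.

(** * Lifting *)

Section UltrametricLift.
Variables (R : realType) (n N : nat) (m : 'I_n -> 'I_n -> nat).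
Hypothesis mC : forall i j, m i j = m j i.
Hypothesis mii : forall i, m i i = 0%N.
Hypothesis m_path :
  forall i j k l, (minn (m i l) (minn (m k l) (m k j)) <= m i j)%N.

(* For each [k] the relation [k < m i j] is a disjoint union of complete
   bipartite graphs and isolated points; [same k i] and [opp k i] are the two
   sides of the component of [i]. *)
Definition opp k i : {set 'I_n} := [set j | (k < m i j)%N].
Definition same k i : {set 'I_n} :=
  i |: [set x | [exists y, (k < m i y)%N && (k < m x y)%N]].

(** Crossing an edge exchanges the two sides of a component: by [m_path], the path [i], [j], [y],
    [x] closes up to an edge from [i] to [x]. *)
Lemma same_opp k i j : (k < m i j)%N -> same k j = opp k i.
Proof.
move=> kij; apply/setP => x; rewrite !inE; apply/orP/idP => [[/eqP -> //|]|kix].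
  move=> /existsP[y /andP[kjy kxy]]; apply: leq_trans (m_path i x y j).
  by rewrite !leq_min kij (mC y j) kjy (mC y x).
by right; apply/existsP; exists i; rewrite (mC j) kij (mC x).
Qed.

(** An integer label of an ordered pair of sides. The sign records the orientation, so that
    exchanging distinct sides negates the label; the successor keeps it nonzero. *)
Definition code (S T : {set 'I_n}) : int :=
  if (enum_rank S < enum_rank T)%N then (pickle (S, T)).+1%:Z
  else - (pickle (T, S)).+1%:Z.

Lemma codeN S T : S != T -> code T S = - code S T.
Proof.
rewrite -(inj_eq enum_rank_inj) -val_eqE /code.
by case: ltngtP => //= _ _; rewrite ?opprK.
Qed.

Lemma code_injl S T S' T' : code S T = code S' T' -> S = S'.
Proof.
rewrite /code; case: ifP => _; case: ifP => _ //.
- by case=> /(pcan_inj pickleK)[].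
- by move=> /oppr_inj[] /(pcan_inj pickleK)[].
Qed.

Lemma code_neq0 S T : code S T != 0.
Proof. by rewrite /code; case: ifP. Qed.

Definition branch_coef i (q : rat) : R[i] :=
  if q * N.+1%:R \is a Num.nat
  then let k := Num.truncn (q * N.+1%:R) in (code (same k i) (opp k i))%:~R
  else 0.

Lemma is_puiseux_branch i : is_puiseux (branch_coef i).
Proof.
exists N.+1, 0; split=> // q; rewrite /branch_coef.
case: ifP => [|_]; last by rewrite eqxx.
move=> /natrP[k qk] _; exists k%:Z => //.
by rewrite -[LHS](mulfK (_ : N.+1%:R != 0)) ?qk ?pnatr_eq0.
Qed.

Definition branch i : puiseux R[i] := mk_puiseux (is_puiseux_branch i).

Lemma same_neq_opp k i : same k i != opp k i.
Proof.
by apply/eqP => /setP/(_ i); rewrite !inE eqxx mii ltn0.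
Qed.

Lemma branch_level i (k : nat) :
  branch_coef i (k%:R / N.+1%:R) = (code (same k i) (opp k i))%:~R.
Proof. by rewrite /branch_coef divfK ?pnatr_eq0 // natr_nat natrK. Qed.

(** Below level [m i j] the vertices [i] and [j] lie on opposite sides of one component, so their
    coefficients cancel. Cancellation at that level would put [i] into [opp k j] with [k = m i j],
    which is false. *)
Lemma lead_branchD i j :
  exists2 c, lead (branch i + branch j) ((m i j)%:R / N.+1%:R) c & c != 0.
Proof.
have codeD k :
    branch_coef i (k%:R / N.+1%:R) + branch_coef j (k%:R / N.+1%:R) =
    (code (same k i) (opp k i) - code (opp k j) (same k j))%:~R.
  by rewrite !branch_level -intrD (codeN (same_neq_opp _ _)) opprK.
exists (branch_coef i ((m i j)%:R / N.+1%:R) +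
        branch_coef j ((m i j)%:R / N.+1%:R)).
  split=> // q lt_q; rewrite /=.
  have [/natrP[k qk]|nq] := boolP (q * N.+1%:R \is a Num.nat); last first.
    by rewrite /branch_coef (negPf nq) addr0.
  have qE : q = k%:R / N.+1%:R by rewrite -qk mulfK ?pnatr_eq0.
  have lt_k : (k < m i j)%N.
    by move: lt_q; rewrite qE ltr_pM2r ?invr_gt0 ?ltr0n // ltr_nat.
  rewrite qE codeD (same_opp lt_k) -(same_opp (i := j) (j := i)) ?subrr //.
  by rewrite mC.
rewrite codeD intr_eq0 subr_eq0; apply/eqP => /code_injl /setP/(_ i).
by rewrite !inE eqxx mC ltnn.
Qed.

Lemma lead_branch i : exists2 c, lead (branch i) 0 c & c != 0.
Proof.
exists (branch_coef i 0); last first.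
  by rewrite -(mul0r N.+1%:R^-1) (branch_level i 0) intr_eq0 code_neq0.
split=> // q q0; rewrite /= /branch_coef ifN //.
by apply/negP => /natr_ge0; rewrite pmulr_lge0 // leNgt q0.
Qed.

Lemma real_branch i : real_puiseux (branch i).
Proof.
move=> q; rewrite /= /branch_coef; case: ifP => // _ /=.
by rewrite -(rmorph_int (real_complex R)).
Qed.

End UltrametricLift.

(** * The real symmetric lift of rank at most two *)

Section RankTwoLift.
Variables (R : realType) (n : nat) (A : 'M[R]_n).
Hypotheses (symA : A^T = A) (no3 : ~~ has_nonsingular_submx A 3).

Lemma trop_sym_rank2 : trop (@real_puiseux R) (@sym_rank_le R n 2) A.
Proof.
have [z sepE] := sep_line symA no3.
apply: closure_mxP => e e0.
(* Four rounding errors add up: those of [u i], [u j], the minimum of [z i] and [z j], and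
   [h i j]. *)
have [N Ne] := exists_round (divr_gt0 e0 (ltr0n R 4)).
pose h i j := height A i j / 2.
have h0 i j : 0 <= h i j by rewrite divr_ge0 ?height_ge0.
pose m i j := Num.truncn (N.+1%:R * h i j).
have hC i j : h i j = h j i by rewrite /h heightC.
have mC i j : m i j = m j i by rewrite /m hC.
have mii i : m i i = 0%N by rewrite /m /h heightii mul0r mulr0 truncn0.
have trunc_min (x y : R) :
    minn (Num.truncn (N.+1%:R * x)) (Num.truncn (N.+1%:R * y)) =
    Num.truncn (N.+1%:R * Num.min x y) :> nat.
  wlog le_xy : x y / x <= y => [W|].
    by case/orP: (le_total x y) => /W //; rewrite minnC minC.
  by rewrite (min_l le_xy); apply/minn_idPl/le_truncn; rewrite ler_pM2l ?ltr0n.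
have m_path i j k l : (minn (m i l) (minn (m k l) (m k j)) <= m i j)%N.
  rewrite /m !trunc_min; apply: le_truncn; rewrite ler_pM2l ?ltr0n //.
  have := height_path symA no3 i j k l; rewrite /h.
  by rewrite !ge_min !ler_pM2r ?invr_gt0 ?ltr0n.
(* Since [h i j] is nonnegative, truncation and floor agree, so the integer levels [m] are exactly
   the rounded heights. *)
have hE i j : ratr (round N (h i j)) = ratr ((m i j)%:R / N.+1%:R) :> R.
  rewrite /m truncn_floor mulr_ge0 //; congr (ratr (_ / _)).
  by rewrite natr_absz ger0_norm // floor_ge0 mulr_ge0.
pose u i := (A i i - z i) / 2.
(* This combines [offset = height - sep] with [2 min(a, b) = a + b - |a - b|]. *)
have AE i j : A i j = u i + u j + Num.min (z i) (z j) + h i j.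
  have [o oE] : exists o, o = offset A i j by exists (offset A i j).
  have := sepE i j; rewrite /u /h /sep /height -oE; move: oE; rewrite /offset.
  case: (leP 0 (- o)) => ?; case: (leP 0 o) => ?; case: (leP (z i) (z j)) => ?;
  by case: (ger0P (z i - z j)) => ? ? ?; lra.
pose z' i := round N (z i); pose u' i := round N (u i).
pose w := branch R N m.
have lead_zw i j : exists2 c, lead (mono _ (z' i) * w i + mono _ (z' j) * w j)
    (Num.min (z' i) (z' j) + (m i j)%:R / N.+1%:R) c & c != 0.
  wlog le_ij : i j / z' i <= z' j => [W|].
    by case/orP: (le_total (z' i) (z' j)) => /W //; rewrite addrC minC mC.
  rewrite min_l //; have [eq_ij|ne_ij] := eqVneq (z' i) (z' j).
    have [c lc c0] := lead_branchD R N mC mii m_path i j.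
    exists (1 * c); last by rewrite mul1r.
    by rewrite -eq_ij -mulrDr; apply: leadM lc; exact: lead_mono.
  (* Distinct rounded positions give positive separation, hence a negative offset and zero
     height. *)
  have -> : m i j = 0%N.
    have : z i != z j by apply: contraNneq ne_ij; rewrite /z' => ->.
    rewrite -subr_eq0 -normr_gt0 -sepE /m /h /sep /height.
    have [_ neg|_] := leP 0 (- offset A i j); last by rewrite ltxx.
    by rewrite max_l ?mul0r ?mulr0 ?truncn0 //; lra.
  have [ci li ci0] := lead_branch R N m i.
  have [cj lj cj0] := lead_branch R N m j.
  exists (1 * ci + 0); last by rewrite addr0 mul1r.
  rewrite mul0r; apply: leadD; first by apply: leadM li; exact: lead_mono.
  apply: (@lead_lt _ _ (z' j + 0) (1 * cj)).
    by apply: leadM lj; exact: lead_mono.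
  by rewrite !addr0 lt_neqAle ne_ij.
pose X : 'cV[puiseux R[i]]_n := \col_i mono _ (u' i).
pose Y : 'cV[puiseux R[i]]_n := \col_i (mono _ (u' i) * (mono _ (z' i) * w i)).
(* This is [Y X^T + X Y^T], written as a product through dimension two to bound its rank. *)
pose M := row_mx Y X *m col_mx X^T Y^T.
have ME i j : M i j = mono _ (u' i + u' j) *
    (mono _ (z' i) * w i + mono _ (z' j) * w j).
  rewrite /M mul_row_col mxE !mxE !big_ord1 !mxE monoD; ring.
have Mval i j : M i j != 0 /\ pval (M i j) =
    u' i + u' j + (Num.min (z' i) (z' j) + (m i j)%:R / N.+1%:R).
  have [c lc c0] := lead_zw i j; rewrite ME; apply: (@lead_pval _ _ _ (1 * c)).
    by apply: leadM lc; exact: lead_mono.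
  by rewrite mul1r.
eexists; first exists M; first split=> [|i j].
- split; last exact: mulmx_max_rank.
  by rewrite /M !mul_row_col linearD /= !trmx_mul !trmxK addrC.
- split; last by have [] := Mval i j.
  rewrite [X in real_puiseux X]ME; apply: real_puiseuxM.
    exact: real_puiseux_mono.
  by apply: real_puiseuxD; apply: real_puiseuxM;
    solve [exact: real_puiseux_mono|exact: real_branch].
- by [].
move=> i j; rewrite mxE (Mval i j).2 AE !rmorphD /= -hE.
have close x : `|x - ratr (round N x)| < e / 4.
  exact: lt_trans (round_close N x) Ne.
move: (close (u i)) (close (u j)) (close (z i)) (close (z j)) (close (h i j)).
rewrite -/(u' i) -/(u' j) -/(z' i) -/(z' j) !ltr_norml.
case: (leP (z' i) (z' j)); rewrite -?(ler_rat R) -?(ltr_rat R);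
  case: (leP (z i) (z j));
  move=> ? ? /andP[? ?] /andP[? ?] /andP[? ?] /andP[? ?] /andP[? ?];
  by apply/andP; split; lra.
Qed.

End RankTwoLift.

Theorem theorem3p3 (R : realType) (n : nat) (A : 'M[R]_n) (symA : A^T = A) :
  has_symmetric_Kapranov_rank (@real_puiseux R) A 2 <->
  symmetric_tropical_rank A = 2%N.
Proof.
rewrite symmetric_tropical_rank_eq2; split=> [[trop2 min2]|[has2 no]].
  split; last by move=> k; exact: trop_sym_rank_singular trop2.
  apply: contraT => no2.
  (* Without a nonsingular 2x2 minor there is a lift of rank at most one, against minimality. *)
  suff /min2 : trop (@real_puiseux R) (@sym_rank_le R n 1) A by [].
  apply: trop_sym_rank1; exact: singular2_half.
split; first by apply: trop_sym_rank2 => //; exact: no.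
move=> s trops; rewrite leqNgt; apply/negP => s2.
by move: has2; rewrite (negPf (trop_sym_rank_singular trops s2)).
Qed.
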